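(* Let $f:\mathbb{R}^d\to(0,\infty]$ be a density satisfying assumption (A) with constants $C_1,C_2\ge 1$, and let $M_2:=(C_1\vee C_2)\|f\|_1$. Then $$f^{n\star}(x)\le\left(\sum_{i=1}^n\binom{n}{i}M_2^{\,n-i}h_i(x)\right)f(x),\qquad x\in\mathbb{R}^d,\ n\in\mathbb{N}.$$
   Context: Let $d\ge 1$, $\mathbb{N}=\{1,2,\dots\}$, $a\vee b=\max(a,b)$; $|x|$ is the Euclidean norm and $\|f\|_1$ the $L^1(\mathbb{R}^d)$ norm (Lebesgue measure). A density is a nonnegative nonzero function in $L^1(\mathbb{R}^d)$. ''Decreasing'' is meant in the non-strict sense; a function is radial decreasing if $f(x)=F(|x|)$ with $F$ nonincreasing on $[0,\infty)$. Convolutions: $f^{1\star}:=f$, $f^{n\star}(x):=\int_{\mathbb{R}^d}f(x-y)f^{(n-1)\star}(y)\,dy$ for $n\ge2$. Assumption (A): $f:\mathbb{R}^d\to(0,\infty]$ is a density such that (a) $f$ is a radial decreasing function; (b) there is a constant $C_1\ge1$ such that $f(x)\le C_1f(y)$ for $1\le|x|\le|y|\le|x|+1$; (c) there is a constant $C_2\ge1$ such that $f(x)\le C_2f(2x)$ for $|x|\le1$. Functions $h_n$: $h_1\equiv1$ on $\mathbb{R}^d$ and, for $n\in\mathbb{N}$, $$h_{n+1}(x):=\frac{\int_{D(x)}f(x-y)f(y)h_n(y)\,dy}{f(x)},\qquad D(x)=\{z\in\mathbb{R}^d:|z|<|x|-1,\ |x-z|<|x|-1\}.$$ An integral over the empty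 set equals $0$ and $a/(+\infty)=0$ for $a\ge0$. *)

(* Defs.v *)
From HB Require Import structures.
From mathcomp Require Import all_boot all_order all_algebra.
From mathcomp Require Import all_classical all_reals all_analysis.
Set Implicit Arguments.
Unset Strict Implicit.
Unset Printing Implicit Defensive.
Import Order.TTheory GRing.Theory Num.Theory.
Local Open Scope classical_set_scope.
Local Open Scope ring_scope.

(* The sigma-algebra on row vectors generated by the coordinate maps (for
   reals: the Borel sigma-algebra), as the library does for n.-tuple T. *)
Definition measure_rV_display : measure_display -> measure_display.
Proof. exact. Qed.

Section measurable_rV.
Context {d} {T : measurableType d}.
Variable n : nat.

Definition rV_coord (i : 'I_n) (x : 'rV[T]_n) : T := x ord0 i.

Let rV_set0 : g_sigma_preimage rV_coord set0.
Proof. exact: sigma_algebra0. Qed.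

Let rV_setC A : g_sigma_preimage rV_coord A -> g_sigma_preimage rV_coord (~` A).
Proof. exact: sigma_algebraC. Qed.

Let rV_bigcup (F : _^nat) : (forall i, g_sigma_preimage rV_coord (F i)) ->
  g_sigma_preimage rV_coord (\bigcup_i (F i)).
Proof. exact: sigma_algebra_bigcup. Qed.

HB.instance Definition _ := @isMeasurable.Build (measure_rV_display d)
  'rV[T]_n (g_sigma_preimage rV_coord) rV_set0 rV_setC rV_bigcup.

Lemma measurable_rV_coord i : measurable_fun setT (rV_coord i).
Proof.
move=> _ Y mY; rewrite setTI; apply: sub_sigma_algebra => /=.
rewrite -bigcup_seq/=; exists i => /=; first by rewrite mem_index_enum.
by exists Y => //; rewrite setTI.
Qed.

End measurable_rV.

Lemma measurable_fun_rVP d1 d2 (T1 : measurableType d1) (T2 : measurableType d2)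
    n (f : T1 -> 'rV[T2]_n) :
  (forall i, measurable_fun setT (fun x => f x ord0 i)) ->
  measurable_fun setT f.
Proof.
move=> mf.
suff H : g_sigma_preimage (fun i => @rV_coord _ T2 n i \o f) `<=` measurable.
  by move=> _ A mA; apply: H; rewrite g_sigma_preimage_comp; exists A.
apply: smallest_sub; first exact: sigma_algebra_measurable.
case: n f mf => [|n] f mf; first by rewrite big_ord0.
rewrite -bigcup_mkord_ord; apply: bigcup_sub => i Ii.
by move=> A [B mB <-]; exact: mf.
Qed.

Section lebesgue_rV.
Context {R : realType}.

(* 'rV_(1 + n) and 'rV_n.+1 are convertible *)
Definition rV_cons n (p : measurableTypeR R * 'rV[R]_n) : 'rV[R]_n.+1 :=
  row_mx (p.1 : R)%:M p.2.

Definition rV_uncons n (x : 'rV[R]_n.+1) : measurableTypeR R * 'rV[R]_n :=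
  (x ord0 ord0, \row_i x ord0 (lift ord0 i)).

Lemma rV_consE0 n p : @rV_cons n p ord0 ord0 = p.1.
Proof.
rewrite /rV_cons (_ : ord0 = lshift n (@ord0 0)); last exact/val_inj.
by rewrite (@row_mxEl _ 1 1 n) mxE.
Qed.

Lemma rV_consES n p j : @rV_cons n p ord0 (lift ord0 j) = p.2 ord0 j.
Proof.
rewrite /rV_cons (_ : lift _ _ = rshift 1 j); last exact/val_inj.
by rewrite (@row_mxEr _ 1 1 n).
Qed.

Lemma rV_consK n : cancel (@rV_cons n) (@rV_uncons n).
Proof.
move=> p; rewrite /rV_uncons rV_consE0 (surjective_pairing p)/=; congr pair.
by apply/rowP => i; rewrite mxE rV_consES.
Qed.

Lemma measurable_rV_cons n : measurable_fun setT (@rV_cons n).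
Proof.
apply: measurable_fun_rVP => i.
have [j ->|->] := unliftP ord0 i.
  rewrite [X in measurable_fun _ X](_ : _ = @rV_coord _ R n j \o snd).
    exact: (measurableT_comp (measurable_rV_coord j) measurable_snd).
  by apply/funext => p; rewrite rV_consES.
rewrite [X in measurable_fun _ X](_ : _ = fst); first exact: measurable_fst.
by apply/funext => p; rewrite rV_consE0.
Qed.

Lemma measurable_rV_uncons n : measurable_fun setT (@rV_uncons n).
Proof.
apply/measurable_fun_pairP; split; first exact: (measurable_rV_coord ord0).
apply: measurable_fun_rVP => i.
rewrite [X in measurable_fun _ X](_ : _ = @rV_coord _ R n.+1 (lift ord0 i)).
  exact: measurable_rV_coord.
by apply/funext => x; rewrite /= mxE.
Qed.

Section step.
Variables (n : nat) (mu : {sigma_finite_measure set 'rV[R]_n -> \bar R}).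

Definition lebesgue_rV_step : set 'rV[R]_n.+1 -> \bar R :=
  pushforward (lebesgue_measure \x mu)%E (@rV_cons n).

Let mcons := @measurable_rV_cons n.

Let step0 : lebesgue_rV_step set0 = 0%E.
Proof. exact: measure0. Qed.

Let step_ge0 A : (0 <= lebesgue_rV_step A)%E.
Proof. exact: measure_ge0. Qed.

Let step_sigma_additive : semi_sigma_additive lebesgue_rV_step.
Proof. exact: measure_semi_sigma_additive. Qed.

HB.instance Definition _ := isMeasure.Build _ _ _ lebesgue_rV_step
  step0 step_ge0 step_sigma_additive.

Let step_sigma_finite : sigma_finite setT lebesgue_rV_step.
Proof.
have /sigma_finiteP[F [TF ndF Foo]] := sigma_finiteT (@lebesgue_measure R).
have /sigma_finiteP[G [TG ndG Goo]] := sigma_finiteT mu.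
exists (fun k => @rV_uncons n @^-1` (F k `*` G k)).
  apply/seteqP; split=> // x _.
  have [i _ Fi] : (\bigcup_k F k) (rV_uncons x).1 by rewrite -TF.
  have [j _ Gj] : (\bigcup_k G k) (rV_uncons x).2 by rewrite -TG.
  exists (maxn i j) => //; split.
  - by move: Fi; apply/subsetPset/ndF/leq_maxl.
  - by move: Gj; apply/subsetPset/ndG/leq_maxr.
move=> k; have [mFk Fkoo] := Foo k; have [mGk Gkoo] := Goo k.
have mFG := measurableX mFk mGk; split.
  by rewrite -[X in measurable X]setTI; exact: measurable_rV_uncons.
rewrite /lebesgue_rV_step /pushforward.
rewrite [X in (_ \x _)%E X](_ : _ = F k `*` G k).
  by rewrite product_measure1E// lte_mul_pinfty// ge0_fin_numE.
by rewrite -comp_preimage (_ : _ \o _ = id) ?preimage_id//; apply/funext/rV_consK.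
Qed.

HB.instance Definition _ := Measure_isSigmaFinite.Build _ _ _ lebesgue_rV_step
  step_sigma_finite.

End step.

(* Lebesgue measure on R^n: the iterated product of the one-dimensional
   Lebesgue measure. *)
Fixpoint lebesgue_rV n : {sigma_finite_measure set 'rV[R]_n -> \bar R} :=
  match n with
  | 0 => [the {sigma_finite_measure set 'rV[R]_0 -> \bar R} of \d_(0 : 'rV[R]_0)]
  | m.+1 => [the {sigma_finite_measure set 'rV[R]_m.+1 -> \bar R} of
             lebesgue_rV_step (lebesgue_rV m)]
  end.

Lemma lebesgue_rV_box n (A : 'I_n -> set (measurableTypeR R)) :
  (forall i, measurable (A i)) ->
  lebesgue_rV n [set x | forall i, A i (x ord0 i)] =
  (\prod_(i < n) lebesgue_measure (A i))%E.
Proof.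
elim: n A => [|n IHn] A mA.
  rewrite big_ord0 /= diracE mem_set//= => i; by case: i.
rewrite big_ord_recl /= /lebesgue_rV_step /pushforward.
rewrite [X in (_ \x _)%E X](_ : _ = A ord0 `*`
    [set x : 'rV[R]_n | forall i, A (lift ord0 i) (x ord0 i)]); last first.
  apply/seteqP; split=> p /=.
    move=> h; split; first by have := h ord0; rewrite rV_consE0.
    by move=> i; have := h (lift ord0 i); rewrite rV_consES.
  move=> [h0 hS] i; have [j ->|->] := unliftP ord0 i.
    by rewrite rV_consES; exact: hS.
  by rewrite rV_consE0.
rewrite product_measure1E//; first by congr (_ * _)%E; exact: IHn.
rewrite [X in measurable X](_ : _ = \bigcap_(i in [set: 'I_n])
    (@rV_coord _ R n i @^-1` A (lift ord0 i))); last first.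
  by apply/seteqP; split=> x h i; [move=> _; exact: h|exact: (h i Logic.I)].
apply: fin_bigcap_measurable => // i _.
by rewrite -[X in measurable X]setTI; apply: measurable_rV_coord => //; exact: mA.
Qed.

End lebesgue_rV.

Section convolution_powers.
Context {R : realType} {d : nat}.
Local Notation Rd := 'rV[R]_d.
Local Notation mu := (@lebesgue_rV R d).
Implicit Types (f g : Rd -> \bar R) (x y z : Rd).

(* The library's norm on 'rV is the sup norm. *)
Definition enorm x : R := Num.sqrt (\sum_(i < d) x ord0 i ^+ 2).

Definition radial_decreasing f : Prop :=
  exists F : R -> \bar R,
    (forall r s : R, 0 <= r -> r <= s -> (F s <= F r)%E) /\
    (forall x, f x = F (enorm x)).

Definition density f : Prop :=
  [/\ forall x, (0 <= f x)%E,
      mu.-integrable setT f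
    & ~ {ae mu, forall x, f x = 0%E}].

Record assumption_A (C1 C2 : R) f : Prop := {
  A_pos : forall x, (0 < f x)%E;
  A_density : density f;
  A_radial : radial_decreasing f;
  A_C1 : 1 <= C1;
  A_shift : forall x y, 1 <= enorm x -> enorm x <= enorm y ->
    enorm y <= enorm x + 1 -> (f x <= C1%:E * f y)%E;
  A_C2 : 1 <= C2;
  A_double : forall x, enorm x <= 1 -> (f x <= C2%:E * f (2 *: x)%R)%E
}.

Definition convolution f g x : \bar R := (\int[mu]_y (f (x - y)%R * g y))%E.

(* Exponent 0 is a junk value. *)
Fixpoint conv_pow f (n : nat) : Rd -> \bar R :=
  match n with
  | 0 => cst 0%E
  | 1 => f
  | m.+1 => convolution f (conv_pow f m)
  end.

Definition Dset x : set Rd :=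
  [set z | enorm z < enorm x - 1 /\ enorm (x - z) < enorm x - 1].

(* Index 0 is a junk value. In \bar R, (+oo)^-1 = 0 and a * 0 = 0 for every a,
   so a / +oo = 0. *)
Fixpoint h_ f (n : nat) : Rd -> \bar R :=
  match n with
  | 0 => cst 0%E
  | 1 => cst 1%E
  | m.+1 => fun x =>
      ((\int[mu]_(y in Dset x) (f (x - y)%R * f y * h_ f m y)) / f x)%E
  end.

End convolution_powers.

(* Main.v *)
Require Import Defs.
From HB Require Import structures.
From mathcomp Require Import all_boot all_order all_algebra.
From mathcomp Require Import all_classical all_reals all_analysis.
From mathcomp Require Import measurable_realfun ring lra.
Import Order.TTheory GRing.Theory Num.Theory.
Local Open Scope classical_set_scope.
Local Open Scope ring_scope.

(** Write f^(n) for the n-fold convolution power, C = C1 v C2, M = C |f|_1, and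
    G_n for the right-hand side ([majorant]), the sum of C(n, i) M^(n-i) h_i f
    with binomial coefficients C(n, i).  The proof is an induction on n that splits the
    integral of f(x - y) f^(n)(y).  On D(x) the induction hypothesis
    f^(n)(y) <= G_n(y) applies, and integration turns h_i into h_{i+1}.  Where
    |x - y| is at least r(|x|) = max(|x| / 2, |x| - 1), the assumption gives
    f(x - y) <= C f(x), and the contribution is at most C |f|_1^n f(x).  Where
    |y| >= r(|x|), the contribution should be at most M G_n(x).  Together with
    Pascal's rule ([majorantS]) the three contributions give G_{n+1}(x).

    The third region needs f^(n)(y) <= C G_n(x) for |y| >= r(|x|).  This does
    not follow from f^(n)(y) <= G_n(y), because h_i need not be monotone.  It is
    instead made part of the induction: [conv_pow_le_majorant] shows
    f^(n)(z) <= C^k G_n(x) whenever |z| is at least the k-fold iterate of r at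
    |x|.  To prove this for n + 1 and k, the hypothesis is used with k + 1 where
    y is large, and a shift of z towards x by a distance k on what remains.

    The second ingredient is that the convolution powers are themselves radial
    and decreasing, so that z may be taken on the segment from 0 to x
    ([convolution_radially_antitone]).  This is proved by comparing the
    convolution at two points through the reflection that swaps them, which
    requires Lebesgue measure to be invariant under reflections
    ([lebesgue_rV_involutive_isometry]); that in turn follows from translation
    invariance and the finite positive measure of the unit ball. *)

(** * Euclidean geometry of row vectors *)

Section euclidean_space.
Context {R : realType} {n : nat}.
Implicit Types x y z : 'rV[R]_n.

Definition dot x y : R := \sum_i x ord0 i * y ord0 i.

Lemma dotC x y : dot x y = dot y x.
Proof. by apply: eq_bigr => i _; rewrite mulrC. Qed.

Lemma dotDl x y z : dot (x + y) z = dot x z + dot y z.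
Proof. by rewrite -big_split; apply: eq_bigr => i _; rewrite mxE mulrDl. Qed.

Lemma dotZl a x y : dot (a *: x) y = a * dot x y.
Proof. by rewrite mulr_sumr; apply: eq_bigr => i _; rewrite mxE mulrA. Qed.

Lemma dotDr x y z : dot z (x + y) = dot z x + dot z y.
Proof. by rewrite dotC dotDl !(dotC _ z). Qed.

Lemma dotZr a x y : dot y (a *: x) = a * dot y x.
Proof. by rewrite dotC dotZl dotC. Qed.

Lemma dotNl x y : dot (- x) y = - dot x y.
Proof. by rewrite -scaleN1r dotZl mulN1r. Qed.

Lemma dotNr x y : dot y (- x) = - dot y x.
Proof. by rewrite dotC dotNl dotC. Qed.

Definition dotE := (dotDl, dotDr, dotNl, dotNr, dotZl, dotZr).

Lemma enormE x : enorm x = Num.sqrt (dot x x).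
Proof. by congr Num.sqrt; apply: eq_bigr => i _; rewrite expr2. Qed.

Lemma dot_ge0 x : 0 <= dot x x.
Proof. by apply: sumr_ge0 => i _; rewrite -expr2 sqr_ge0. Qed.

Lemma dot_eq0 x : (dot x x == 0) = (x == 0).
Proof.
rewrite psumr_eq0 => [|i _]; last by rewrite -expr2 sqr_ge0.
apply/allP/eqP => [h|-> i _]; last by rewrite mxE mulr0 eqxx.
apply/rowP => i; rewrite mxE; apply/eqP.
by have := h i (mem_index_enum i); rewrite /= mulf_eq0 orbb.
Qed.

Lemma enorm_ge0 x : 0 <= enorm x.
Proof. exact: sqrtr_ge0. Qed.

Lemma sqr_enorm x : enorm x ^+ 2 = dot x x.
Proof. by rewrite enormE sqr_sqrtr ?dot_ge0. Qed.

Lemma ler_enorm x y : (enorm x <= enorm y) = (dot x x <= dot y y).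
Proof. by rewrite !enormE ler_sqrt ?dot_ge0. Qed.

Lemma eq_enorm x y : dot x x = dot y y -> enorm x = enorm y.
Proof. by rewrite !enormE => ->. Qed.

Lemma enormZ a x : enorm (a *: x) = `|a| * enorm x.
Proof.
by rewrite !enormE !dotE mulrA -expr2 sqrtrM ?sqr_ge0// sqrtr_sqr.
Qed.

Lemma enormN x : enorm (- x) = enorm x.
Proof. by apply: eq_enorm; rewrite !dotE opprK. Qed.

Lemma enorm_distC x y : enorm (x - y) = enorm (y - x).
Proof. by rewrite -enormN opprB. Qed.

(** Expanding the nonnegative square of <y,y> x - <x,y> y gives
    <y,y> (<x,x> <y,y> - <x,y>^2) >= 0. *)
Lemma cauchy_schwarz x y : dot x y <= enorm x * enorm y.
Proof.
have [xy0|xy0] := leP (dot x y) 0.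
  by rewrite (le_trans xy0)// mulr_ge0 ?enorm_ge0.
rewrite -(@ler_pXn2r _ 2)// ?nnegrE ?mulr_ge0 ?enorm_ge0 ?(ltW xy0)//.
rewrite exprMn !sqr_enorm.
have [y0|y0] := eqVneq (dot y y) 0.
  move/eqP: y0; rewrite dot_eq0 => /eqP ->.
  by rewrite -(scale0r 0) !dotE !mul0r mulr0 expr0n.
have py : 0 < dot y y by rewrite lt_def y0 dot_ge0.
have := dot_ge0 (dot y y *: x - dot x y *: y).
rewrite !dotE (dotC y x) => h.
rewrite -subr_ge0 -(pmulr_rge0 _ py).
by move: h; congr (0 <= _); ring.
Qed.

Lemma ler_enormD x y : enorm (x + y) <= enorm x + enorm y.
Proof.
rewrite -(@ler_pXn2r _ 2)// ?nnegrE ?addr_ge0 ?enorm_ge0//.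
rewrite sqrrD !sqr_enorm !dotE (dotC y x).
have := cauchy_schwarz x y; lra.
Qed.

Lemma ler_enorm_dist x y z : enorm (x - z) <= enorm (x - y) + enorm (y - z).
Proof. by rewrite -[x - z](subrKA y) ler_enormD. Qed.

End euclidean_space.

(** * Translation invariance of Lebesgue measure *)

Section lebesgue_rV_invariance.
Context {R : realType}.

Lemma measurable_rV_add d (n : nat) (T : measurableType d) (g h : T -> 'rV[R]_n) :
  measurable_fun setT g -> measurable_fun setT h ->
  measurable_fun setT (fun x => g x + h x).
Proof.
move=> mg mh; apply: measurable_fun_rVP => i.
under eq_fun do rewrite mxE.
apply: measurable_funD.
  exact: (measurableT_comp (@measurable_rV_coord _ R n i) mg).
exact: (measurableT_comp (@measurable_rV_coord _ R n i) mh).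
Qed.

Lemma measurable_rV_scale d (n : nat) (T : measurableType d) (k : T -> R)
    (g : T -> 'rV[R]_n) :
  measurable_fun setT k -> measurable_fun setT g ->
  measurable_fun setT (fun x => k x *: g x).
Proof.
move=> mk mg; apply: measurable_fun_rVP => i.
under eq_fun do rewrite mxE.
apply: measurable_funM => //.
exact: (measurableT_comp (@measurable_rV_coord _ R n i) mg).
Qed.

Lemma measurable_rV_sub d (n : nat) (T : measurableType d) (g h : T -> 'rV[R]_n) :
  measurable_fun setT g -> measurable_fun setT h ->
  measurable_fun setT (fun x => g x - h x).
Proof.
move=> mg mh; apply: measurable_rV_add => //.
under eq_fun do rewrite -scaleN1r.
exact: measurable_rV_scale.
Qed.

Lemma measurable_enorm n : measurable_fun setT (@enorm R n).
Proof.
rewrite /enorm.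
have mq : measurable_fun setT (fun x : 'rV[R]_n => \sum_i x ord0 i ^+ 2).
  apply: measurable_sum => i; apply: measurable_funX.
  exact: (@measurable_rV_coord _ R n i).
apply: (measurableT_comp _ mq).
exact: continuous_measurable_fun (@sqrt_continuous R).
Qed.

(** Lebesgue measure on the line is determined by its values on half-open
    intervals, and its image under a translation has the same values there. *)
Lemma lebesgue_integral_translation (g : measurableTypeR R -> \bar R) (a : R) :
  measurable_fun setT g -> (forall x, 0 <= g x)%E ->
  (\int[lebesgue_measure]_x g (x + a)%R = \int[lebesgue_measure]_x g x)%E.
Proof.
move=> mg g0.
pose phi (x : measurableTypeR R) : measurableTypeR R := (x : R) + a.
have mphi : measurable_fun setT phi.
  by apply: measurable_funD => //; exact: measurable_cst.
have -> : (\int[lebesgue_measure]_x g x =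
    \int[pushforward lebesgue_measure phi]_x g x)%E.
  apply: eq_measure_integral => A mA _.
  apply: (@lebesgue_measure_unique _ (pushforward lebesgue_measure phi)) => //.
  move=> _ [[b c] _ <-] /=.
  rewrite /pushforward [X in _ = lebesgue_measure X](_ : _ = `]b - a, c - a]%classic).
    rewrite !lebesgue_measure_itv /= !lte_fin ltrD2r.
    by case: ifP => // _; rewrite -!EFinB; congr EFin; ring.
  apply/seteqP; split=> x; rewrite /phi /= !in_itv /=;
    by rewrite ltrBlDr lerBrDr.
by rewrite ge0_integral_pushforward.
Qed.

Lemma ge0_integral_rV_step n (g : 'rV[R]_n.+1 -> \bar R) :
  measurable_fun setT g -> (forall x, 0 <= g x)%E ->
  (\int[lebesgue_rV n.+1]_x g x =
   \int[lebesgue_measure]_s \int[lebesgue_rV n]_v g (rV_cons (s, v)))%E.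
Proof.
move=> mg g0; rewrite ge0_integral_pushforward//; last exact: measurable_rV_cons.
rewrite preimage_setT fubini_tonelli1 => [//||x]; last exact: g0.
exact: (measurableT_comp mg (@measurable_rV_cons R n)).
Qed.

(** Induction on the dimension: by Tonelli the first coordinate is translated on
    the line and the remaining ones in one dimension less. *)
Lemma lebesgue_rV_translation n (a : 'rV[R]_n) (g : 'rV[R]_n -> \bar R) :
  measurable_fun setT g -> (forall x, 0 <= g x)%E ->
  (\int[lebesgue_rV n]_x g (x + a)%R = \int[lebesgue_rV n]_x g x)%E.
Proof.
elim: n a g => [|n IH] a g mg g0.
  by apply: eq_integral => x _; congr g; apply/rowP => -[].
have mga : measurable_fun setT (fun x : 'rV[R]_n.+1 => g (x + a)).
  by apply: (measurableT_comp mg); apply: measurable_rV_add => //; exact: measurable_cst.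
rewrite !ge0_integral_rV_step//.
pose b : 'rV[R]_n := \row_i a ord0 (lift ord0 i).
have mgc : measurable_fun setT (g \o @rV_cons R n).
  exact: (measurableT_comp mg (@measurable_rV_cons R n)).
pose G s := (\int[lebesgue_rV n]_v g (rV_cons (s, v)))%E.
transitivity (\int[lebesgue_measure]_s G (s + a ord0 ord0)%R)%E.
  apply: eq_integral => s _; rewrite /G.
  rewrite -(IH b (fun v => g (rV_cons (s + a ord0 ord0, v))))//.
    apply: eq_integral => v _; congr g; apply/rowP => i; rewrite mxE.
    have [j ->|->] := unliftP ord0 i; last by rewrite !rV_consE0.
    by rewrite !rV_consES /= !mxE.
  exact: (measurableT_comp mgc (pair1_measurable (s + a ord0 ord0 : measurableTypeR R))).
rewrite lebesgue_integral_translation//.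
- apply: (measurable_fun_fubini_tonelli_F (g \o @rV_cons R n)) => [|p].
    exact: mgc.
  exact: g0.
- by move=> s; apply: integral_ge0.
Qed.

End lebesgue_rV_invariance.

(** * Invariance of Lebesgue measure under linear isometries *)

Section isometry_invariance.
Context {R : realType} {n : nat}.
Local Notation Rn := 'rV[R]_n.
Local Notation mu := (@lebesgue_rV R n).

Lemma measurable_rV_box (A : 'I_n -> set (measurableTypeR R)) :
  (forall i, measurable (A i)) ->
  measurable [set x : Rn | forall i, A i (x ord0 i)].
Proof.
move=> mA; rewrite [X in measurable X](_ : _ = \bigcap_(i in [set: 'I_n])
    (@rV_coord _ R n i @^-1` A i)).
  apply: fin_bigcap_measurable => // i _.
  rewrite -[X in measurable X]setTI; apply: measurable_rV_coord => //.
  exact: mA.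
by apply/seteqP; split=> x h i; [move=> _; exact: h|exact: (h i Logic.I)].
Qed.

Definition unit_ball : set Rn := [set x | enorm x <= 1].

Lemma measurable_unit_ball : measurable unit_ball.
Proof.
have -> : unit_ball = (@enorm R n) @^-1` `]-oo, 1]%classic.
  by apply/seteqP; split=> x; rewrite /unit_ball /= in_itv.
by rewrite -[X in measurable X]setTI; exact: measurable_enorm.
Qed.

(** The ball lies in the cube of side 2. *)
Lemma unit_ball_lty : (mu unit_ball < +oo)%E.
Proof.
pose A (i : 'I_n) : set (measurableTypeR R) := `[-1, 1]%classic.
have mA i : measurable (A i) by exact: measurable_itv.
have mB := measurable_rV_box _ mA.
apply: (@le_lt_trans _ _ (mu [set x : Rn | forall i, A i (x ord0 i)])).
  apply: le_measure; rewrite ?inE//; first exact: measurable_unit_ball.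
  move=> x; rewrite /unit_ball /= => x1 i.
  rewrite /A /= in_itv /= -ler_norml -sqrtr_sqr (le_trans _ x1)//.
  rewrite /enorm ler_sqrt ?sumr_ge0// => [|j _]; last exact: sqr_ge0.
  by rewrite (bigD1 i)//= lerDl sumr_ge0// => j _; exact: sqr_ge0.
rewrite lebesgue_rV_box// (eq_bigr (fun=> 2%:E))//.
  by rewrite prodEFin ltry.
by move=> i _; rewrite /A lebesgue_measure_itv /= lte_fin ifT -?EFinB ?opprK//.
Qed.

(** The ball contains a cube of positive side; the side 1 / (n + 1) is small
    enough for the squared norm n / (n + 1)^2 of its far corner to be at most 1,
    and it is also meaningful for n = 0. *)
Lemma unit_ball_gt0 : (0 < mu unit_ball)%E.
Proof.
pose A (i : 'I_n) : set (measurableTypeR R) := `[0, n.+1%:R^-1]%classic.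
have mA i : measurable (A i) by exact: measurable_itv.
have mB := measurable_rV_box _ mA.
apply: (@lt_le_trans _ _ (mu [set x : Rn | forall i, A i (x ord0 i)])).
  rewrite lebesgue_rV_box// (eq_bigr (fun=> (n.+1%:R^-1)%:E)).
    by rewrite prodEFin lte_fin prodr_gt0// => i _; rewrite invr_gt0.
  move=> i _; rewrite /A lebesgue_measure_itv /= lte_fin invr_gt0 ltr0Sn.
  by rewrite -EFinB subr0.
apply: le_measure; rewrite ?inE//; first exact: measurable_unit_ball.
move=> x; rewrite /unit_ball /enorm /= => h.
rewrite -[leRHS]sqrtr1 ler_sqrt//.
apply: (@le_trans _ _ (\sum_(i < n) n.+1%:R^-1)).
  apply: ler_sum => i _; have := h i; rewrite /A /= in_itv /= => /andP[x0 xn].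
  rewrite expr2 (le_trans _ xn)// ler_piMl// (le_trans xn)//.
  by rewrite invf_le1// ler1n.
by rewrite sumr_const card_ord -[leLHS]mulr_natl ler_pdivrMr// mul1r ler_nat.
Qed.

(** Translation invariance fixes the measure up to a factor, and the unit ball B,
    whose indicator a is invariant under L, fixes the factor.  Integrate
    a(x) b(x + L y) in both orders.  With y inside, x + L y = L (y + L x) and a
    translation of y gives |B| times the integral of b o L; with x inside, a
    translation of x followed by one of y, which uses a(x - L y) = a(L x - y),
    gives |B| times the integral of b.  As 0 < |B| < oo, the two integrals
    agree. *)
Lemma lebesgue_rV_involutive_isometry (L : Rn -> Rn) (b : Rn -> \bar R) :
  measurable_fun setT L -> {morph L : x y / x + y} -> involutive L ->
  (forall x, enorm (L x) = enorm x) ->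
  measurable_fun setT b -> (forall x, 0 <= b x)%E ->
  (\int[mu]_x b (L x) = \int[mu]_x b x)%E.
Proof.
move=> mL LD LK Ln mb b0.
have LN x : L (- x) = - L x.
  have L0 : L 0 = 0 by apply: (addrI (L 0)); rewrite -LD !addr0.
  by apply: (addrI (L x)); rewrite -LD !subrr.
pose a (x : Rn) : \bar R := (\1_unit_ball x)%:E.
have aE x y : enorm x = enorm y -> a x = a y.
  by move=> xy; rewrite /a !indicE; rewrite (_ : (x \in unit_ball) = (y \in unit_ball))//;
    apply/idP/idP; rewrite !inE /unit_ball /= xy.
have ma : measurable_fun setT a.
  by apply/measurable_EFinP; exact: measurable_indic measurable_unit_ball.
have a0 x : (0 <= a x)%E by rewrite lee_fin.
have mLb : measurable_fun setT (fun x => b (L x)) by exact: measurableT_comp mb mL.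
have Ia : (\int[mu]_x a x = mu unit_ball)%E.
  by rewrite integral_indic ?setIT//; exact: measurable_unit_ball.
have mF : measurable_fun setT (fun p : Rn * Rn => (a p.1 * b (p.1 + L p.2)%R)%E).
  apply: emeasurable_funM; first exact: (measurableT_comp ma measurable_fst).
  apply: (measurableT_comp mb); apply: measurable_rV_add => //.
  exact: (measurableT_comp mL measurable_snd).
have mG : measurable_fun setT (fun p : Rn * Rn => (a (p.1 - L p.2)%R * b p.1)%E).
  apply: emeasurable_funM; last exact: (measurableT_comp mb measurable_fst).
  apply: (measurableT_comp ma); apply: measurable_rV_sub => //.
  exact: (measurableT_comp mL measurable_snd).
have E1 : (\int[mu]_x \int[mu]_y (a x * b (x + L y)%R) =
    mu unit_ball * \int[mu]_x b (L x))%E.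
  rewrite -Ia -ge0_integralZr//; last by apply: integral_ge0.
  apply: eq_integral => x _.
  rewrite ge0_integralZl//; last first.
    apply: (measurableT_comp mb); apply: measurable_rV_add => //; exact: measurable_cst.
  congr (_ * _)%E; rewrite -(lebesgue_rV_translation n (L x) _ mLb)//.
  by apply: eq_integral => y _; rewrite LD LK addrC.
have E2 : (\int[mu]_y \int[mu]_x (a x * b (x + L y)%R) =
    mu unit_ball * \int[mu]_x b x)%E.
  transitivity (\int[mu]_y \int[mu]_x (a (x - L y)%R * b x))%E.
    apply: eq_integral => y _.
    rewrite -(@lebesgue_rV_translation _ _ (L y) (fun x => (a (x - L y)%R * b x)%E)).
    - by apply: eq_integral => x _; rewrite addrK.
    - exact: (measurableT_comp mG (pair2_measurable y)).
    - by move=> x; rewrite mule_ge0.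
  rewrite -(fubini_tonelli (fun p : Rn * Rn => (a (p.1 - L p.2)%R * b p.1)%E))//; last first.
    by move=> p; rewrite mule_ge0.
  rewrite -ge0_integralZl//.
  apply: eq_integral => x _ /=.
  rewrite ge0_integralZr//; last first.
    by apply: (measurableT_comp ma); apply: measurable_rV_sub => //; exact: measurable_cst.
  congr (_ * _)%E; rewrite -Ia -(lebesgue_rV_translation n (- L x) _ ma)//.
  apply: eq_integral => y _; apply: aE.
  by rewrite enorm_distC -Ln LD LK LN addrC; congr (enorm (_ + _)).
have := E1.
rewrite (fubini_tonelli (fun p : Rn * Rn => (a p.1 * b (p.1 + L p.2)%R)%E))//= => [|p]; last first.
  by rewrite mule_ge0.
rewrite E2 => /esym.
have Bf : mu unit_ball \is a fin_num by rewrite ge0_fin_numE ?unit_ball_lty.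
move=> /(congr1 (fun t => (mu unit_ball)^-1 * t)%E); rewrite !muleA.
by rewrite mulVe// ?gt_eqF ?unit_ball_gt0// !mul1e.
Qed.

End isometry_invariance.

(** * Convolution preserves radial monotonicity *)

Section convolution_monotone.
Context {R : realType} {n : nat}.
Local Notation Rn := 'rV[R]_n.
Local Notation mu := (@lebesgue_rV R n).
Implicit Types (f g : Rn -> \bar R) (x y z w : Rn).

Lemma measurable_dotl w : measurable_fun setT (fun x : Rn => dot x w).
Proof.
apply: measurable_sum => i; apply: measurable_funM; last exact: measurable_cst.
exact: (@measurable_rV_coord _ R n i).
Qed.

Definition householder w x : Rn := x - (2 * dot x w / dot w w) *: w.

Lemma householderD w : {morph householder w : x y / x + y}.
Proof.
move=> x y; rewrite /householder !dotE.
by rewrite addrACA -opprD -scalerDl mulrDr mulrDl.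
Qed.

Lemma householderK w : w != 0 -> involutive (householder w).
Proof.
rewrite -dot_eq0 => w0 x; rewrite /householder !dotE.
rewrite -addrA -opprD -scalerDl.
rewrite [X in X *: w](_ : _ = 0) ?scale0r ?subr0//.
by field.
Qed.

Lemma enorm_householder w x : w != 0 -> enorm (householder w x) = enorm x.
Proof.
rewrite -dot_eq0 => w0; apply: eq_enorm; rewrite /householder !dotE (dotC w x).
by field.
Qed.

Lemma measurable_householder w : measurable_fun setT (householder w).
Proof.
apply: measurable_rV_sub => //; apply: measurable_rV_scale.
  under eq_fun do rewrite -mulrA mulrC.
  by apply: measurable_funM => //; apply: measurable_funM => //; exact: measurable_dotl.
exact: measurable_cst.
Qed.

(** The reflection in the hyperplane that bisects the segment from x to z; it
    exchanges x and z.  The bisecting hyperplane is that of the vectors y with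
    2 <y, z - x> = <z,z> - <x,x>, hence the added multiple of z - x. *)
Definition swap_reflection x z y : Rn :=
  householder (z - x) y + ((dot z z - dot x x) / dot (z - x) (z - x)) *: (z - x).

Lemma measurable_swap_reflection x z : measurable_fun setT (swap_reflection x z).
Proof.
by apply: measurable_rV_add; [exact: measurable_householder|exact: measurable_cst].
Qed.

Lemma swap_reflection_integral x z g : x != z ->
  measurable_fun setT g -> (forall y, 0 <= g y)%E ->
  (\int[mu]_y g (swap_reflection x z y) = \int[mu]_y g y)%E.
Proof.
rewrite eq_sym -subr_eq0 => w0 mg g0; rewrite /swap_reflection.
set v := _ *: (z - x).
rewrite (@lebesgue_rV_involutive_isometry _ _ (householder (z - x)) (fun y => g (y + v))).
- exact: lebesgue_rV_translation.
- exact: measurable_householder.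
- exact: householderD.
- exact: householderK.
- by move=> y; exact: enorm_householder.
- apply: (measurableT_comp mg); apply: measurable_rV_add => //; exact: measurable_cst.
- by [].
Qed.

Lemma enorm_right_sub_swap x z y : x != z ->
  enorm (z - swap_reflection x z y) = enorm (x - y).
Proof.
rewrite eq_sym -subr_eq0 -dot_eq0 => w0.
apply: eq_enorm; move: w0; rewrite /swap_reflection /householder !dotE.
rewrite (dotC z y) (dotC x y) (dotC z x) => w0.
by field.
Qed.

Lemma enorm_left_sub_swap x z y : x != z ->
  enorm (x - swap_reflection x z y) = enorm (z - y).
Proof.
rewrite eq_sym -subr_eq0 -dot_eq0 => w0.
apply: eq_enorm; move: w0; rewrite /swap_reflection /householder !dotE.
rewrite (dotC z y) (dotC x y) (dotC z x) => w0.
by field.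
Qed.

(** If x is at least as close to the origin as z, then the origin lies on the
    side of x of the bisecting hyperplane.  So a point y on the side of x is
    both closer to x than to z and closer to the origin than its mirror image,
    and on the other side both comparisons are reversed. *)
Lemma swap_reflection_side x z y : x != z -> enorm x <= enorm z ->
  (enorm (x - y) <= enorm (z - y) /\ enorm y <= enorm (swap_reflection x z y)) \/
  (enorm (z - y) <= enorm (x - y) /\ enorm (swap_reflection x z y) <= enorm y).
Proof.
move=> xz; rewrite !ler_enorm => xz2.
move: (xz); rewrite eq_sym -subr_eq0 -dot_eq0 => w0.
have w1 : 0 < dot (z - x) (z - x) by rewrite lt_def w0 dot_ge0.
(* the sign of t tells on which side of the bisecting hyperplane y lies *)
pose t := 2 * dot y z - 2 * dot y x - (dot z z - dot x x).
have -> : dot (swap_reflection x z y) (swap_reflection x z y) =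
    dot y y - t * ((dot z z - dot x x) / dot (z - x) (z - x)).
  move: w0; rewrite /t /swap_reflection /householder !dotE.
  rewrite (dotC z y) (dotC x y) (dotC z x) => w0.
  by field.
have -> : dot (x - y) (x - y) = dot (z - y) (z - y) + t.
  by rewrite /t !dotE (dotC z y) (dotC x y); ring.
have q0 : 0 <= (dot z z - dot x x) / dot (z - x) (z - x).
  by rewrite divr_ge0 ?dot_ge0// subr_ge0.
have [t0|t0] := leP t 0; [left|right].
  by rewrite gerDl t0 lerDl oppr_ge0 mulr_le0_ge0.
by rewrite lerDl gerDl oppr_le0 ltW//= mulr_ge0// ltW.
Qed.

Lemma rearrangement_lee (a b c d : \bar R) : (0 <= b)%E -> (b <= a)%E ->
  (0 <= d)%E -> (d <= c)%E -> (a * d + b * c <= a * c + b * d)%E.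
Proof.
move=> b0 ba d0 dc.
have a0 := le_trans b0 ba; have c0 := le_trans d0 dc.
have bd0 : (0 <= b * d)%E by exact: mule_ge0.
have [aE|an0] := eqVneq a 0%E.
  have -> : b = 0%E by apply/eqP; rewrite eq_le b0 -aE ba.
  by rewrite aE !mul0e.
have [cE|cn0] := eqVneq c 0%E.
  have -> : d = 0%E by apply/eqP; rewrite eq_le d0 -cE dc.
  by rewrite cE !mule0.
have pa : (0 < a)%E by rewrite lt_def an0.
have pc : (0 < c)%E by rewrite lt_def cn0.
have [aoo|af] := eqVneq a +oo%E.
  by rewrite [in leRHS]aoo gt0_mulye// addye ?leey// gt_eqF// (lt_le_trans _ bd0).
have [coo|cf] := eqVneq c +oo%E.
  by rewrite [in leRHS]coo gt0_muley// addye ?leey// gt_eqF// (lt_le_trans _ bd0).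
move: a b c d b0 ba d0 dc a0 c0 af cf {bd0 an0 cn0 pa pc}.
move=> [a| |] [b| |] [c| |] [d| |]//=.
rewrite -!EFinM -!EFinD !lee_fin => b0 ba d0 dc _ _ _ _.
rewrite -subr_ge0 (_ : _ - _ = (a - b) * (c - d)); last by ring.
by rewrite mulr_ge0 ?subr_ge0.
Qed.

Lemma lee_double_inv (x y : \bar R) : (x + x <= y + y)%E -> (x <= y)%E.
Proof.
case: x => [x| |]; case: y => [y| |] //=; rewrite ?leey ?leNye//.
by rewrite -!EFinD !lee_fin; lra.
Qed.

Lemma integral_sub_left g x :
  measurable_fun setT g -> (forall y, 0 <= g y)%E ->
  (\int[mu]_y g (x - y)%R = \int[mu]_y g y)%E.
Proof.
move=> mg g0.
have mN : measurable_fun setT (fun y : Rn => - y).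
  rewrite (_ : -%R = fun y : Rn => 0 - y); last by apply/funext => y; rewrite sub0r.
  by apply: measurable_rV_sub => //; exact: measurable_cst.
have mNg : measurable_fun setT (fun y : Rn => g (- y)) by exact: measurableT_comp mg mN.
transitivity (\int[mu]_y g (- y)%R)%E.
  rewrite -(lebesgue_rV_translation n (- x) _ mNg)//.
  by apply: eq_integral => y _; rewrite opprD opprK addrC.
apply: (lebesgue_rV_involutive_isometry (fun y : Rn => - y)) => //.
- exact: opprD.
- exact: opprK.
- exact: enormN.
Qed.

(** For f nonincreasing in this sense, points of equal norm have equal values:
    the predicate contains the radial symmetry. *)
Definition radially_antitone g := forall x z, enorm x <= enorm z -> (g z <= g x)%E.

(** Twice the convolution at z is the integral of
    f(z - y) g(y) + f(x - y) g(y'), where y' is the mirror image of y under the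
    reflection that swaps x and z, and twice the convolution at x is the integral
    of f(x - y) g(y) + f(z - y) g(y').  By [swap_reflection_side] the larger
    value of f meets the larger value of g in the second integrand, which is
    therefore the larger one by the rearrangement inequality.  Adding integrals
    instead of subtracting them lets f and g be infinite. *)
Lemma convolution_radially_antitone f g :
  measurable_fun setT f -> (forall x, 0 <= f x)%E -> radially_antitone f ->
  measurable_fun setT g -> (forall x, 0 <= g x)%E -> radially_antitone g ->
  radially_antitone (convolution f g).
Proof.
move=> mf f0 fr mg g0 gr x z xz.
have [->//|nxz] := eqVneq x z.
have eqn h u v : radially_antitone h -> enorm u = enorm v -> h u = h v.
  by move=> hr uv; apply/eqP; rewrite eq_le !hr ?uv.
have mshift u : measurable_fun setT (fun y => f (u - y)%R).
  by apply: (measurableT_comp mf); apply: measurable_rV_sub => //; exact: measurable_cst.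
have mI u : measurable_fun setT (fun y => (f (u - y)%R * g y)%E).
  exact: emeasurable_funM.
have mg' : measurable_fun setT (fun y => g (swap_reflection x z y)).
  exact: (measurableT_comp mg (measurable_swap_reflection x z)).
have mI' u : measurable_fun setT (fun y => (f (u - y)%R * g (swap_reflection x z y))%E).
  exact: emeasurable_funM.
have double u v : (forall y, enorm (u - swap_reflection x z y) = enorm (v - y)) ->
    (convolution f g u + convolution f g u =
     \int[mu]_y (f (u - y)%R * g y + f (v - y)%R * g (swap_reflection x z y)))%E.
  move=> uv; rewrite ge0_integralD//; try by move=> y _; rewrite mule_ge0.
  congr (_ + _)%E; rewrite /convolution.
  rewrite -(swap_reflection_integral x z _ nxz (mI u)); last by move=> y; rewrite mule_ge0.
  by apply: eq_integral => y _; rewrite (eqn f _ _ fr (uv y)).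
apply: lee_double_inv.
rewrite (double z x) => [|y]; last exact: enorm_right_sub_swap.
rewrite (double x z) => [|y]; last exact: enorm_left_sub_swap.
apply: ge0_le_integral => //.
- by move=> y _; rewrite adde_ge0 ?mule_ge0.
- exact: emeasurable_funD.
- exact: emeasurable_funD.
move=> y _.
have [[h1 h2]|[h1 h2]] := swap_reflection_side x z y nxz xz.
- by rewrite [leLHS]addeC rearrangement_lee// ?fr ?gr.
- by rewrite [leRHS]addeC rearrangement_lee// ?fr ?gr.
Qed.

End convolution_monotone.

(** * The shrunken radius *)

Section shrinking_radius.
Context {R : realType}.
Implicit Types s t v : R.

(** The radius from which a density as in assumption (A) is at most (C1 v C2)
    times its value at radius t: for t <= 2 it is t / 2, from the doubling
    condition (c), and beyond it is t - 1, from the shift condition (b).  Two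
    balls of radius [shrink t] around points at distance t can only meet for
    t > 2, see [lt_half_shrink]; for t > 2 their intersection is the set D. *)
Definition shrink t : R := Num.max (t / 2) (t - 1).

Lemma shrink_ge0 t : 0 <= t -> 0 <= shrink t.
Proof. by move=> t0; rewrite le_max divr_ge0. Qed.

Lemma ler_shrink s t : s <= t -> shrink s <= shrink t.
Proof.
move=> st; rewrite /shrink ge_max !le_max.
by apply/andP; split; apply/orP; [left|right]; lra.
Qed.

Lemma shrink_le t : 0 <= t -> shrink t <= t.
Proof. by move=> t0; rewrite /shrink ge_max; apply/andP; split; lra. Qed.

Lemma shrinkE t : 2 <= t -> shrink t = t - 1.
Proof. by move=> t2; apply/max_idPr; lra. Qed.

Lemma lt_half_shrink t : t < shrink t + shrink t -> 2 < t.
Proof. by rewrite /shrink; case: (leP (t / 2) (t - 1)) => h1 h2; lra. Qed.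

Lemma iter_shrink_ge0 k t : 0 <= t -> 0 <= iter k shrink t.
Proof. by move=> t0; elim: k => //= k; exact: shrink_ge0. Qed.

Lemma iter_shrink_le k t : 0 <= t -> iter k shrink t <= t.
Proof.
move=> t0; elim: k => //= k; apply: le_trans.
by rewrite shrink_le ?iter_shrink_ge0.
Qed.

Lemma iter_ler_shrink k s t : s <= t -> iter k shrink s <= iter k shrink t.
Proof. by move=> st; elim: k => //= k; exact: ler_shrink. Qed.

Lemma iter_shrinkD k v : 1 <= v -> iter k shrink (v + k%:R) = v.
Proof.
move=> v1; elim: k => [|k IH]; first by rewrite addr0.
rewrite iterSr shrinkE; first by rewrite -natr1 addrA addrK.
rewrite -natr1; have : 0 <= k%:R :> R by []. lra.
Qed.

(** Above radius 2 every step that was made is a step of length exactly 1. *)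
Lemma iter_shrink_gt2 k t : 2 < iter k shrink t -> t = iter k shrink t + k%:R.
Proof.
elim: k t => [t|k IH t]; first by rewrite addr0.
rewrite iterSr => h; rewrite -natr1 addrA -IH//.
have : 2 < shrink t.
  have := IH _ h; have : 0 <= k%:R :> R by []. lra.
by rewrite /shrink; case: (leP (t / 2) (t - 1)) => h1 h2; lra.
Qed.

End shrinking_radius.

Section rescaling.
Context {R : realType} {n : nat}.
Implicit Types x : 'rV[R]_n.

Definition rescale s x := (s / enorm x) *: x.

Lemma enorm_rescale s x : 0 <= s -> s <= enorm x -> enorm (rescale s x) = s.
Proof.
move=> s0 sx; rewrite enormZ ger0_norm ?divr_ge0 ?enorm_ge0//.
have [x0|x0] := eqVneq (enorm x) 0; last by rewrite divfK.
by rewrite x0 mulr0; apply/eqP; rewrite eq_le s0 -x0 sx.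
Qed.

Lemma enorm_sub_rescale s x : 0 <= s -> s <= enorm x ->
  enorm (x - rescale s x) = enorm x - s.
Proof.
move=> s0 sx; have [x0|x0] := eqVneq (enorm x) 0.
  have -> : s = 0 by apply/eqP; rewrite eq_le s0 -x0 sx.
  by rewrite /rescale mul0r scale0r !subr0.
have xp : 0 < enorm x by rewrite lt_def x0 enorm_ge0.
rewrite /rescale -{1}[x]scale1r -scalerBl enormZ ger0_norm.
  by rewrite mulrBl mul1r divfK.
by rewrite subr_ge0 ler_pdivrMr// mul1r.
Qed.

End rescaling.

(** * Convolution powers *)

Section convolution_integral.
Context {R : realType} {n : nat}.
Local Notation Rn := 'rV[R]_n.
Local Notation mu := (@lebesgue_rV R n).
Variables f g : Rn -> \bar R.
Hypotheses (mf : measurable_fun setT f) (f0 : forall x, (0 <= f x)%E).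
Hypotheses (mg : measurable_fun setT g) (g0 : forall x, (0 <= g x)%E).

Lemma measurable_convolution_kernel :
  measurable_fun setT (fun p : Rn * Rn => (f (p.1 - p.2)%R * g p.2)%E).
Proof.
apply: emeasurable_funM; last exact: (measurableT_comp mg measurable_snd).
apply: (measurableT_comp mf); apply: measurable_rV_sub.
  exact: measurable_fst.
exact: measurable_snd.
Qed.

Lemma measurable_convolution : measurable_fun setT (convolution f g).
Proof.
apply: (measurable_fun_fubini_tonelli_F _ measurable_convolution_kernel).
by move=> p; rewrite mule_ge0.
Qed.

Lemma convolution_ge0 x : (0 <= convolution f g x)%E.
Proof. by apply: integral_ge0 => y _; rewrite mule_ge0. Qed.

Lemma integral_convolution :
  (\int[mu]_x convolution f g x = \int[mu]_x f x * \int[mu]_x g x)%E.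
Proof.
rewrite /convolution.
rewrite (fubini_tonelli _ measurable_convolution_kernel)/=; last first.
  by move=> p; rewrite mule_ge0.
rewrite -ge0_integralZl//; last by apply: integral_ge0.
apply: eq_integral => y _; rewrite ge0_integralZr//.
  by rewrite (lebesgue_rV_translation _ (- y)).
by apply: (measurableT_comp mf); apply: measurable_rV_sub => //; exact: measurable_cst.
Qed.

End convolution_integral.

Section convolution_powers.
Context {R : realType} {n : nat}.
Local Notation Rn := 'rV[R]_n.
Local Notation mu := (@lebesgue_rV R n).
Variable f : Rn -> \bar R.
Hypotheses (mf : measurable_fun setT f) (f0 : forall x, (0 <= f x)%E).

Lemma conv_powS m : conv_pow f m.+2 = convolution f (conv_pow f m.+1).
Proof. by []. Qed.

Lemma measurable_conv_pow_ge0 m :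
  measurable_fun setT (conv_pow f m.+1) /\ forall x, (0 <= conv_pow f m.+1 x)%E.
Proof.
elim: m => [//|m [mm m0]]; rewrite conv_powS.
by split=> [|x]; [exact: measurable_convolution|exact: convolution_ge0].
Qed.

Lemma measurable_conv_pow m : measurable_fun setT (conv_pow f m.+1).
Proof. by have [] := measurable_conv_pow_ge0 m. Qed.

Lemma conv_pow_ge0 m x : (0 <= conv_pow f m.+1 x)%E.
Proof. by have [] := measurable_conv_pow_ge0 m. Qed.

Lemma conv_pow_radially_antitone m :
  radially_antitone f -> radially_antitone (conv_pow f m.+1).
Proof.
move=> fr; elim: m => [//|m IH]; rewrite conv_powS.
apply: convolution_radially_antitone => //.
- exact: measurable_conv_pow.
- exact: conv_pow_ge0.
Qed.

Lemma integral_conv_pow m :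
  (\int[mu]_x conv_pow f m.+1 x = (\int[mu]_x f x) ^+ m.+1)%E.
Proof.
elim: m => [//|m IH]; rewrite conv_powS integral_convolution//.
- by rewrite IH.
- exact: measurable_conv_pow.
- exact: conv_pow_ge0.
Qed.

End convolution_powers.

(** * The recursion for the majorant *)

Section renewal_weights.
Context {R : realType} {n : nat}.
Local Notation Rn := 'rV[R]_n.
Local Notation mu := (@lebesgue_rV R n).
Variable f : Rn -> \bar R.
Hypotheses (mf : measurable_fun setT f) (fpos : forall x, (0 < f x)%E).

(** The products h_i f, rather than the quotients h_i, are what the proof
    integrates and compares. *)
Definition hmulf i x : \bar R := (h_ f i x * f x)%E.

Lemma h_ge0 i x : (0 <= h_ f i x)%E.
Proof.
elim: i x => [//|[|i] IH x]; first exact: lee01.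
change (0 <= (\int[mu]_(y in Dset x) (f (x - y)%R * f y * h_ f i.+1 y)) / f x)%E.
rewrite mule_ge0//; last by rewrite inve_ge0 ltW.
by apply: integral_ge0 => y _; rewrite !mule_ge0 ?IH// ltW.
Qed.

Lemma hmulf_ge0 i x : (0 <= hmulf i x)%E.
Proof. by rewrite mule_ge0 ?h_ge0// ltW. Qed.

Lemma hmulf1 x : hmulf 1 x = f x.
Proof. by rewrite /hmulf /= mul1e. Qed.

Lemma hmulfS i x : f x \is a fin_num ->
  hmulf i.+2 x = (\int[mu]_(y in Dset x) (f (x - y)%R * hmulf i.+1 y))%E.
Proof.
move=> fx; rewrite {1}/hmulf.
rewrite -[h_ f i.+2 x]/((\int[mu]_(y in Dset x) (f (x - y)%R * f y * h_ f i.+1 y)) / f x)%E.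
rewrite -muleA mulVe ?gt_eqF// mule1.
by apply: eq_integral => y _; rewrite -muleA [(f y * _)%E]muleC.
Qed.

(** Where f is infinite the division by f makes h vanish, so the product differs
    there from the integral in [hmulfS]. *)
Lemma hmulf_pinfty i x : f x = +oo%E -> hmulf i.+2 x = 0%E.
Proof. by move=> fx; rewrite /hmulf /= fx invey mule0 mul0e. Qed.

Lemma measurable_Dset_graph : measurable [set p : Rn * Rn | Dset p.1 p.2].
Proof.
have m1 : measurable_fun setT (fun p : Rn * Rn => enorm p.1 - 1).
  apply: measurable_funB => //.
  exact: (measurableT_comp (@measurable_enorm R n) measurable_fst).
have -> : [set p : Rn * Rn | Dset p.1 p.2] =
    (fun p : Rn * Rn => (enorm p.2 < enorm p.1 - 1) && (enorm (p.1 - p.2) < enorm p.1 - 1))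
    @^-1` [set true].
  by apply/seteqP; split=> p; rewrite /Dset /= => /andP.
rewrite -[X in measurable X]setTI.
apply: measurable_and => //; apply: measurable_fun_ltr => //.
  exact: (measurableT_comp (@measurable_enorm R n) measurable_snd).
apply: (measurableT_comp (@measurable_enorm R n)).
by apply: measurable_rV_sub; [exact: measurable_fst|exact: measurable_snd].
Qed.

Lemma measurable_Dset (x : Rn) : measurable (Dset x).
Proof.
have := pair1_measurable x measurableT measurable_Dset_graph.
by rewrite setTI.
Qed.

(** The product is the integral of [hmulfS] cut off to the set where f is
    finite, and the integral is measurable by Tonelli since the graph of D is. *)
Lemma measurable_hmulf i : measurable_fun setT (hmulf i.+1).
Proof.
elim: i => [|i IH].
  by rewrite (_ : hmulf 1 = f)//; apply/funext => x; exact: hmulf1.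
pose k := (fun p : Rn * Rn => f (p.1 - p.2)%R * hmulf i.+1 p.2)%E \_
  [set p : Rn * Rn | Dset p.1 p.2].
have mk : measurable_fun setT k.
  apply/(measurable_restrictT _ measurable_Dset_graph).
  exact: (measurable_funTS (measurable_convolution_kernel f _ mf IH)).
have k0 p : (0 <= k p)%E.
  by rewrite /k patchE; case: ifP => // _; rewrite mule_ge0 ?hmulf_ge0// ltW.
have mfin : measurable [set x | f x \is a fin_num].
  by rewrite -[X in measurable X]setTI; apply: emeasurable_fin_num.
rewrite (_ : hmulf i.+2 = (fubini_F mu k) \_ [set x | f x \is a fin_num]).
  apply/(measurable_restrictT _ mfin); apply: measurable_funTS.
  exact: measurable_fun_fubini_tonelli_F.
apply/funext => x; rewrite patchE; case: ifPn; rewrite ?inE/= => fx.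
  rewrite hmulfS// integral_mkcond; apply: eq_integral => y _.
  rewrite /k !patchE/=.
  by rewrite (_ : ((x, y) \in _) = (y \in Dset x))//; apply/idP/idP; rewrite !inE.
apply: hmulf_pinfty; move: fx; rewrite notin_setE /= ge0_fin_numE ?ltW// => /negP.
by rewrite -leNgt leye_eq => /eqP.
Qed.

Definition majorant (M : R) m x : \bar R :=
  (\sum_(1 <= i < m.+1) ('C(m, i)%:R * M ^+ (m - i))%:E * hmulf i x)%E.

Variables (M : R).
Hypothesis (M0 : 0 < M).

Lemma majorant_coef_ge0 m i : 0 <= 'C(m, i)%:R * M ^+ (m - i).
Proof. by rewrite mulr_ge0// exprn_ge0// ltW. Qed.

Lemma majorant_ge0 m x : (0 <= majorant M m x)%E.
Proof.
by apply: sume_ge0 => i _; rewrite mule_ge0 ?hmulf_ge0// lee_fin majorant_coef_ge0.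
Qed.

Lemma measurable_majorant m : measurable_fun setT (majorant M m).
Proof.
rewrite /majorant; under eq_fun do rewrite big_add1 /=.
apply: emeasurable_sum => i; apply: measurable_funeM; exact: measurable_hmulf.
Qed.

Lemma majorant_pinfty m x : f x = +oo%E -> majorant M m.+1 x = +oo%E.
Proof.
move=> fx; rewrite /majorant big_nat_recl//= hmulf1 fx gt0_muley ?lte_fin; last first.
  by rewrite mulr_gt0 ?exprn_gt0// bin1.
rewrite addye// gt_eqF// (@lt_le_trans _ _ 0%E)//.
by apply: sume_ge0 => i _; rewrite mule_ge0 ?hmulf_ge0// lee_fin majorant_coef_ge0.
Qed.

(** Pascal's rule: C(m+2, i) = C(m+1, i) + C(m+1, i-1).  The first half gives the
    term with the factor M; in the second half the index i = 1 gives M^(m+1) f,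
    and integration over D carries the summand i to the summand i + 1. *)
Lemma majorantS m x : f x \is a fin_num ->
  majorant M m.+2 x =
  (M%:E * majorant M m.+1 x + (M ^+ m.+1)%:E * f x +
   \int[mu]_(y in Dset x) (f (x - y)%R * majorant M m.+1 y))%E.
Proof.
move=> fx.
have -> : (\int[mu]_(y in Dset x) (f (x - y)%R * majorant M m.+1 y) =
    \sum_(1 <= i < m.+2) ('C(m.+1, i)%:R * M ^+ (m.+1 - i))%:E * hmulf i.+1 x)%E.
  have mfx : measurable_fun (Dset x) (fun y => f (x - y)%R).
    apply: measurable_funTS; apply: (measurableT_comp mf).
    by apply: measurable_rV_sub => //; exact: measurable_cst.
  have mD := measurable_Dset x.
  rewrite big_add1/=.
  transitivity (\int[mu]_(y in Dset x) \sum_(0 <= i < m.+1)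
      (('C(m.+1, i.+1)%:R * M ^+ (m.+1 - i.+1))%:E * (f (x - y)%R * hmulf i.+1 y)))%E.
    apply: eq_integral => y _; rewrite /majorant big_add1/= ge0_sume_distrr.
      by apply: eq_bigr => i _; rewrite muleCA.
    by move=> i _; rewrite mule_ge0 ?hmulf_ge0// lee_fin majorant_coef_ge0.
  have fh0 i y : (0 <= f (x - y)%R * hmulf i.+1 y)%E.
    by rewrite mule_ge0 ?hmulf_ge0// ltW.
  have mfh i : measurable_fun (Dset x) (fun y => (f (x - y)%R * hmulf i.+1 y)%E).
    apply: emeasurable_funM => //; apply: measurable_funTS; exact: measurable_hmulf.
  rewrite ge0_integral_sum//=.
  - apply: eq_bigr => i _; rewrite ge0_integralZl ?hmulfS// lee_fin.
    exact: majorant_coef_ge0.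
  - by move=> i; exact: measurable_funeM.
  - by move=> i y _; rewrite mule_ge0// lee_fin majorant_coef_ge0.
rewrite -addeA.
have -> : ((M ^+ m.+1)%:E * f x +
    \sum_(1 <= i < m.+2) ('C(m.+1, i)%:R * M ^+ (m.+1 - i))%:E * hmulf i.+1 x)%E
  = (\sum_(1 <= i < m.+3) ('C(m.+1, i.-1)%:R * M ^+ (m.+1 - i.-1))%:E * hmulf i x)%E.
  by rewrite [in RHS]big_nat_recl//= bin0 subn0 mul1r hmulf1.
have -> : (M%:E * majorant M m.+1 x)%E = 
   (\sum_(1 <= i < m.+3) (M * ('C(m.+1, i)%:R * M ^+ (m.+1 - i)))%:E * hmulf i x)%E.
  rewrite [in RHS]big_nat_recr//= bin_small// mul0r mulr0 mul0e adde0.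
  rewrite /majorant ge0_sume_distrr => [|i _]; last first.
    by rewrite mule_ge0 ?hmulf_ge0// lee_fin majorant_coef_ge0.
  by apply: eq_bigr => i _; rewrite muleA EFinM.
rewrite -big_split/= /majorant; apply: eq_big_nat => -[//|i] /andP[_ im] /=.
have -> : 'C(m.+2, i.+1)%:R * M ^+ (m.+2 - i.+1) =
    M * ('C(m.+1, i.+1)%:R * M ^+ (m.+1 - i.+1)) + 'C(m.+1, i)%:R * M ^+ (m.+1 - i).
  rewrite binS natrD mulrDl subSS; congr (_ + _).
  move: im; rewrite !ltnS leq_eqVlt => /orP[/eqP ->|im].
    by rewrite bin_small// !mul0r mulr0.
  by rewrite mulrCA -exprS -subSn.
rewrite EFinD ge0_muleDl// lee_fin ?majorant_coef_ge0//.
by rewrite mulr_ge0 ?majorant_coef_ge0// ltW.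
Qed.

End renewal_weights.

(** * The bound for convolution powers *)

Section convolution_power_bound.
Context {R : realType} {n : nat}.
Local Notation Rn := 'rV[R]_n.
Local Notation mu := (@lebesgue_rV R n).
Variables (C1 C2 : R) (f : Rn -> \bar R).
Hypothesis fA : assumption_A C1 C2 f.

Let C := Num.max C1 C2.
Let mass := fine (\int[mu]_x f x).
Let M := C * mass.

Let fpos x : (0 < f x)%E := A_pos fA x.
Let f0 x : (0 <= f x)%E := ltW (fpos x).

Let C_ge1 : 1 <= C.
Proof. by rewrite le_max (A_C1 fA). Qed.

Let C_gt0 : 0 < C.
Proof. exact: lt_le_trans C_ge1. Qed.

Let mf : measurable_fun setT f.
Proof. by have [_ fi _] := A_density fA; exact: measurable_int fi. Qed.

Let fr : radially_antitone f.
Proof.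
have [F [Fdecr fF]] := A_radial fA => x z xz.
by rewrite !fF; apply: Fdecr => //; exact: enorm_ge0.
Qed.

Lemma integral_densityE :
  (\int[mu]_x f x = (fine (\int[mu]_x f x))%:E)%E.
Proof.
have [_ /integrableP[_ fi] _] := A_density fA.
rewrite fineK// ge0_fin_numE; last by apply: integral_ge0.
by move: fi; under eq_integral do rewrite gee0_abs//.
Qed.

Let massE : (\int[mu]_x f x = mass%:E)%E := integral_densityE.

Let mass_gt0 : 0 < mass.
Proof.
have [_ _ fn0] := A_density fA.
rewrite -lte_fin -massE lt_def integral_ge0// andbT.
apply/eqP => If; apply: fn0.
have /ae_eq_integral_abs : measurable_fun setT f := mf.
move=> /(_ mu measurableT)[+ _]; under eq_integral do rewrite gee0_abs//.
by move=> /(_ If); apply: filterS => x; exact.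
Qed.

Let M_gt0 : 0 < M.
Proof. exact: mulr_gt0. Qed.

Lemma density_shrink x z : shrink (enorm x) <= enorm z -> (f z <= C%:E * f x)%E.
Proof.
rewrite /shrink ge_max => /andP[hz1 hz2].
have CfM c (w : \bar R) : c <= C -> (0 <= w)%E -> (c%:E * w <= C%:E * w)%E.
  by move=> cC w0; rewrite lee_wpmul2r// lee_fin.
have [xz|zx] := leP (enorm x) (enorm z).
  rewrite (le_trans (fr _ _ xz))//; rewrite -[leLHS]mul1e; exact: CfM.
have [x2|x2] := leP (enorm x) 2.
  pose w := 2^-1 *: x.
  have wE : enorm w = enorm x / 2.
    by rewrite enormZ ger0_norm ?invr_ge0// mulrC.
  apply: (@le_trans _ _ (f w)); first by apply: fr; rewrite wE.
  apply: (@le_trans _ _ (C2%:E * f (2 *: w)))%E.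
    by apply: (A_double fA); rewrite wE; lra.
  rewrite /w scalerA divff// scale1r; apply: CfM => //.
  by rewrite le_max lexx orbT.
apply: (@le_trans _ _ (C1%:E * f x))%E.
  by apply: (A_shift fA); lra.
by apply: CfM => //; rewrite le_max lexx.
Qed.

Lemma density_iter_shrink k x z : iter k shrink (enorm x) <= enorm z ->
  (f z <= (C ^+ k)%:E * f x)%E.
Proof.
elim: k x => [x|k IH x]; first by rewrite mul1e; exact: fr.
have sx0 := shrink_ge0 _ (enorm_ge0 x).
have sx := enorm_rescale _ _ sx0 (shrink_le _ (enorm_ge0 x)).
rewrite iterSr -sx => /IH /le_trans; apply.
rewrite exprS EFinM -muleA muleCA lee_wpmul2l//.
  by rewrite lee_fin exprn_ge0// ltW.
by apply: density_shrink; rewrite sx.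
Qed.

(** The induction over the convolution power needs the bound at all radii
    obtained from |x| by k shrinking steps, at the price of the factor C^k.
    First z may be moved to the point z' of norm u on the segment from 0 to x, since
    the convolution powers are radially nonincreasing.  In the integral of
    f(z' - y) f^(m+1)(y) every y falls under one of three cases:
    - |y| >= shrink u: the induction hypothesis with k + 1 steps bounds
      f^(m+1)(y);
    - |z' - y| >= shrink u: then f(z' - y) <= C^(k+1) f(x);
    - otherwise u > 2, so that |x| = u + k and |x - z'| = k; then y lies in D(x),
      f(z' - y) <= C^k f(x - y), and the induction hypothesis without shrinking
      bounds f^(m+1)(y).
    The extra factor C in the first two cases is absorbed by M = C |f|_1, and
    the three contributions are the summands of [majorantS]. *)
Lemma conv_pow_le_majorant m k x z : iter k shrink (enorm x) <= enorm z ->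
  (conv_pow f m.+1 z <= (C ^+ k)%:E * majorant f M m.+1 x)%E.
Proof.
elim: m k x z => [|m IH] k x z hz.
  rewrite /majorant big_nat1 subnn expr0 mulr1 mul1e hmulf1.
  exact: density_iter_shrink.
have Ck0 j : 0 < C ^+ j by rewrite exprn_gt0.
have [fx|fx] := eqVneq (f x) +oo%E.
  by rewrite majorant_pinfty// gt0_muley ?leey ?lte_fin.
have {fx}fx : f x \is a fin_num by rewrite ge0_fin_numE// ltey.
have u0 := iter_shrink_ge0 k _ (enorm_ge0 x).
have ux := iter_shrink_le k _ (enorm_ge0 x).
set u := iter k shrink (enorm x) in hz u0 ux.
have := conv_pow_radially_antitone f mf f0 m.+1 fr (rescale u x) z.
rewrite enorm_rescale// => /(_ hz)/le_trans; apply.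
set z' := rescale u x.
have z'u : enorm z' = u by exact: enorm_rescale.
have z'x : enorm (x - z') = enorm x - u by exact: enorm_sub_rescale.
rewrite conv_powS /convolution.
set g := conv_pow f m.+1; set G := majorant f M m.+1.
have mg : measurable_fun setT g := measurable_conv_pow f mf f0 m.
have g0 y : (0 <= g y)%E := conv_pow_ge0 f mf f0 m y.
have mG : measurable_fun setT G := measurable_majorant f mf fpos M m.+1.
have G0 y : (0 <= G y)%E by exact: majorant_ge0.
have mfs (w : Rn) : measurable_fun setT (fun y : Rn => f (w - y)%R).
  by apply: (measurableT_comp mf); apply: measurable_rV_sub => //; exact: measurable_cst.
(* the three bounds of the integrand, one for each position of y *)
pose t1 y := (f (z' - y)%R * ((C ^+ k.+1)%:E * G x))%E.
pose t2 y := ((C ^+ k.+1)%:E * f x * g y)%E.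
pose t3 y := ((C ^+ k)%:E * ((fun y => f (x - y)%R * G y)%E \_ (Dset x)) y)%E.
have mt1 : measurable_fun setT t1.
  by apply: emeasurable_funM => //; exact: measurable_cst.
have mt2 : measurable_fun setT t2.
  by apply: emeasurable_funM => //; exact: measurable_cst.
have mp : measurable_fun setT ((fun y => f (x - y)%R * G y)%E \_ (Dset x)).
  apply/(measurable_restrictT _ (measurable_Dset x)); apply: measurable_funTS.
  exact: emeasurable_funM.
have mt3 : measurable_fun setT t3 by exact: measurable_funeM.
have p0 y : (0 <= ((fun y => f (x - y)%R * G y)%E \_ (Dset x)) y)%E.
  by rewrite patchE; case: ifP => // _; rewrite mule_ge0.
have Ckf j : (0 <= (C ^+ j)%:E)%E by rewrite lee_fin ltW.
have t10 y : (0 <= t1 y)%E by rewrite !mule_ge0.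
have t20 y : (0 <= t2 y)%E by rewrite !mule_ge0.
have t30 y : (0 <= t3 y)%E by rewrite mule_ge0.
apply: (@le_trans _ _ (\int[mu]_y (t1 y + t2 y + t3 y)))%E.
  apply: ge0_le_integral => //.
  - by move=> y _; rewrite mule_ge0.
  - exact: emeasurable_funM.
  - by apply: emeasurable_funD => //; exact: emeasurable_funD.
  move=> y _.
  have [yu|yu] := leP (shrink u) (enorm y).
    apply: (@le_trans _ _ (t1 y)); last by rewrite -addeA leeDl// adde_ge0.
    by rewrite lee_wpmul2l//; exact: IH.
  have [zyu|zyu] := leP (shrink u) (enorm (z' - y)).
    apply: (@le_trans _ _ (t2 y)); last by rewrite addeAC leeDr// adde_ge0.
    by rewrite lee_wpmul2r//; exact: density_iter_shrink.
  have uy := ler_enorm_dist z' y 0.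
  rewrite !subr0 in uy.
  have u2 : 2 < u by apply: lt_half_shrink; lra.
  have xE := iter_shrink_gt2 _ _ u2; rewrite -/u in xE.
  have := shrinkE _ (ltW u2) => su.
  have xzk : enorm (x - z') = k%:R by rewrite z'x; lra.
  have xy := ler_enorm_dist x z' y; rewrite xzk in xy.
  apply: (@le_trans _ _ (t3 y)); last by rewrite leeDr// adde_ge0.
  rewrite /t3 patchE ifT; last first.
    by rewrite inE /Dset /=; have : 0 <= k%:R :> R by []; split; lra.
  rewrite muleA; apply: lee_pmul => //.
  - apply: density_iter_shrink.
    have : iter k shrink (enorm (x - y)) <= iter k shrink (enorm (z' - y) + k%:R).
      by apply: iter_ler_shrink; lra.
    by rewrite iter_shrinkD//; lra.
  - by have := IH 0%N y y (lexx _); rewrite mul1e.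
have I1 : (\int[mu]_y t1 y = (C ^+ k)%:E * (M%:E * G x))%E.
  rewrite /t1 ge0_integralZr//; last by rewrite mule_ge0.
  have -> : (\int[mu]_y f (z' - y)%R = mass%:E)%E.
    by rewrite -massE; exact: integral_sub_left.
  by rewrite !muleA -!EFinM; congr (_%:E * _)%E; rewrite /M exprS; ring.
have I2 : (\int[mu]_y t2 y <= (C ^+ k)%:E * ((M ^+ m.+1)%:E * f x))%E.
  rewrite /t2 ge0_integralZl//; last by rewrite mule_ge0.
  rewrite integral_conv_pow// massE -EFin_expe muleAC muleA -!EFinM.
  rewrite lee_wpmul2r// lee_fin /M exprMn mulrA ler_wpM2r ?exprn_ge0 ?(ltW mass_gt0)//.
  rewrite exprSr ler_wpM2l ?(ltW (Ck0 k))// exprS ler_peMr ?(ltW C_gt0)//.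
  exact: exprn_ege1.
have I3 : (\int[mu]_y t3 y =
    (C ^+ k)%:E * \int[mu]_(y in Dset x) (f (x - y)%R * G y))%E.
  by rewrite /t3 ge0_integralZl// -integral_mkcond.
have mt12 : measurable_fun setT (fun y => t1 y + t2 y)%E by exact: emeasurable_funD.
rewrite ge0_integralD//; last by move=> y _; rewrite adde_ge0.
rewrite ge0_integralD// I1 I3 majorantS// -/G.
have J0 : (0 <= \int[mu]_(y in Dset x) (f (x - y)%R * G y))%E.
  by apply: integral_ge0 => y _; rewrite mule_ge0.
have MG0 : (0 <= M%:E * G x)%E by rewrite mule_ge0// lee_fin ltW.
have Mf0 : (0 <= (M ^+ m.+1)%:E * f x)%E by rewrite mule_ge0// lee_fin exprn_ge0// ltW.
move: (\int[mu]_(y in Dset x) _)%E J0 => J J0.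
rewrite !ge0_muleDr ?adde_ge0//.
by rewrite leeD2r// leeD2l.
Qed.

Lemma conv_pow_bound m x :
  (conv_pow f m.+1 x <= majorant f (C * mass) m.+1 x)%E.
Proof. by have := conv_pow_le_majorant m 0 x x (lexx _); rewrite mul1e. Qed.

End convolution_power_bound.

Theorem theorem2p2 (R : realType) (d : nat) (hd : (0 < d)%N)
    (C1 C2 : R) (f : 'rV[R]_d -> \bar R) (hf : assumption_A C1 C2 f) :
  let M2 := ((Num.max C1 C2)%:E * 'N[lebesgue_rV d]_1[f])%E in
  forall (x : 'rV[R]_d) (n : nat), (0 < n)%N ->
  (conv_pow f n x <=
   (\sum_(1 <= i < n.+1) ('C(n, i)%:R)%:E * M2 ^+ (n - i) * h_ f i x) * f x)%E.
Proof.
move=> M2 x [//|n] _.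
have M2E : M2 = (Num.max C1 C2 * fine (\int[lebesgue_rV d]_x f x))%:E.
  rewrite /M2 Lnorm1 (eq_integral f) => [|y _]; last by rewrite gee0_abs// ltW// (A_pos hf).
  by rewrite (integral_densityE C1 C2 f hf).
have M2_ge0 : (0 <= M2)%E.
  by rewrite /M2 mule_ge0 ?Lnorm_ge0// lee_fin (le_trans ler01)// le_max (A_C1 hf).
have h0 i : (0 <= h_ f i x)%E by apply: h_ge0; exact: A_pos hf.
apply: (le_trans (conv_pow_bound C1 C2 f hf n x)).
rewrite ge0_sume_distrl => [|i _]; last first.
  by rewrite !mule_ge0 ?expe_ge0.
rewrite /majorant; apply: lee_sum => i _.
by rewrite M2E -EFin_expe -EFinM /hmulf muleA.
Qed.
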